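(* Let $\beta>0$, $\nu\in(0,1)$, and let $\{\xi^k\}$ be the sequence generated by the primal-dual algorithm described in the context. Let $$\mathcal H=\begin{pmatrix} (1+\frac1\nu)I_m & (1+\frac1\nu)I_m & I_m \\ (1+\frac1\nu)I_m & (1+\frac2\nu)I_m & I_m \\ I_m & I_m & I_m \end{pmatrix},\qquad \mathcal G=\begin{pmatrix} (2-\nu)I_m & I_m & I_m \\ I_m & (2-\nu)I_m & I_m \\ I_m & I_m & I_m \end{pmatrix}.$$ Then $$\|\xi^{k+1}-\xi^*\|_{\mathcal H}^2\le\|\xi^k-\xi^*\|_{\mathcal H}^2-\|\xi^k-\tilde\xi^k\|_{\mathcal G}^2\qquad\forall\,\xi^*\in\Xi^*,$$ and thus the sequence $\{\xi^k\}$ converges to some $\xi^*\in\Xi^*$.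
   Context: Problem: $\min\{\theta_1(x)+\theta_2(y)\mid Ax+By=b\ (\text{or }\ge b),\ x\in\mathcal X,\ y\in\mathcal Y\}$, where $\theta_i:\mathbb R^{n_i}\to\mathbb R$ ($i=1,2$) are closed proper convex functions (not necessarily smooth), $\mathcal X\subseteq\mathbb R^{n_1}$, $\mathcal Y\subseteq\mathbb R^{n_2}$ are closed convex sets, $A\in\mathbb R^{m\times n_1}$, $B\in\mathbb R^{m\times n_2}$, $b\in\mathbb R^m$. Put $\Lambda=\mathbb R^m$ in the equality case and $\Lambda=\mathbb R^m_+$ in the inequality case, and $\Omega=\mathcal X\times\mathcal Y\times\Lambda$. Write $w=(x,y,\lambda)$, $u=(x,y)$, $\theta(u)=\theta_1(x)+\theta_2(y)$, $F(w)=(-A^T\lambda,\,-B^T\lambda,\,Ax+By-b)$. $\Omega^*$ is the set of all $w^*\in\Omega$ with $\theta(u)-\theta(u^* )+(w-w^* )^TF(w^* )\ge0$ for all $w\in\Omega$. Standing assumption: $\Omega^*\ne\emptyset$. Let $P=\mathrm{diag}(\sqrt\beta A,\sqrt\beta B,\tfrac1{\sqrt\beta}I_m)$ and $\Xi^*=\{Pw^*\mid w^*\in\Omega^*\}\subseteq\mathbb R^{3m}$. $\|v\|_{\mathcal H}^2=v^T\mathcal Hv$. Primal-dual algorithm. The iterates are triples of $m$-vectors $(a^k,c^k,\lambda^k)$, where $a^k$ stands for ''$Ax^k$'' and $c^k$ for ''$By^k$'' (these are treated as aggregate vectors in $\mathbb R^m$). Given $(a^k,c^k,\lambda^k)$: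 1. Prediction: find $\tilde w^k=(\tilde x^k,\tilde y^k,\tilde\lambda^k)$ with $\tilde x^k\in\arg\min\{\theta_1(x)-x^TA^T\lambda^k+\frac\beta2\|Ax-a^k\|^2\mid x\in\mathcal X\}$, $\tilde y^k\in\arg\min\{\theta_2(y)-y^TB^T\lambda^k+\frac\beta2\|(By-c^k)+(A\tilde x^k-a^k)\|^2\mid y\in\mathcal Y\}$, $\tilde\lambda^k=\arg\max\{-\lambda^T(A\tilde x^k+B\tilde y^k-b)-\frac1{2\beta}\|\lambda-\lambda^k\|^2\mid\lambda\in\Lambda\}$. 2. Correction: $$\begin{pmatrix} a^{k+1} \\ c^{k+1} \\ \lambda^{k+1} \end{pmatrix}=\begin{pmatrix} a^k \\ c^k \\ \lambda^k \end{pmatrix}-\begin{pmatrix} \nu I_m & -\nu I_m & 0 \\ 0 & \nu I_m & 0 \\ -\nu\beta I_m & 0 & I_m \end{pmatrix}\begin{pmatrix} a^k-A\tilde x^k \\ c^k-B\tilde y^k \\ \lambda^k-\tilde\lambda^k \end{pmatrix}.$$ The subproblem solutions are assumed to exist, so that the sequence is generated. Set $\xi^k=(\sqrt\beta a^k,\sqrt\beta c^k,\frac1{\sqrt\beta}\lambda^k)$ and $\tilde\xi^k=P\tilde w^k=(\sqrt\beta A\tilde x^k,\sqrt\beta B\tilde y^k,\frac1{\sqrt\beta}\tilde\lambda^k)$.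
   Formalization: The subproblems are assumed solvable for every value of (a,c,λ), not only along the generated sequence; with solvability along the run alone, the iterates can converge to a point outside Ξ*. *)

(* Defs.v *)
From HB Require Import structures.
From mathcomp Require Import all_boot all_order all_algebra.
From mathcomp Require Import all_classical all_reals all_analysis.

Set Implicit Arguments.
Unset Strict Implicit.
Unset Printing Implicit Defensive.

Import Order.TTheory GRing.Theory Num.Theory.
Import numFieldNormedType.Exports.

Local Open Scope classical_set_scope.
Local Open Scope ring_scope.

Definition dot (R : realType) n (u v : 'cV[R]_n) : R := (u^T *m v) 0 0.

(* The library norm `|v| on matrices is the sup norm, hence this definition. *)
Definition sqnorm (R : realType) n (v : 'cV[R]_n) : R := dot v v.

Definition wsqnorm (R : realType) n (H : 'M[R]_n) (v : 'cV[R]_n) : R :=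
  (v^T *m H *m v) 0 0.

Definition col3 (R : realType) p1 p2 p3
    (u1 : 'cV[R]_p1) (u2 : 'cV[R]_p2) (u3 : 'cV[R]_p3) : 'cV[R]_(p1 + p2 + p3) :=
  col_mx (col_mx u1 u2) u3.

Definition block3 (R : realType) p1 p2 p3 q1 q2 q3
    (M11 : 'M[R]_(p1, q1)) (M12 : 'M[R]_(p1, q2)) (M13 : 'M[R]_(p1, q3))
    (M21 : 'M[R]_(p2, q1)) (M22 : 'M[R]_(p2, q2)) (M23 : 'M[R]_(p2, q3))
    (M31 : 'M[R]_(p3, q1)) (M32 : 'M[R]_(p3, q2)) (M33 : 'M[R]_(p3, q3)) :
    'M[R]_(p1 + p2 + p3, q1 + q2 + q3) :=
  block_mx (block_mx M11 M12 M21 M22) (col_mx M13 M23) (row_mx M31 M32) M33.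

Definition is_argmin (R : realType) (T : Type) (S : set T) (f : T -> R) (x : T) :=
  S x /\ forall y, S y -> f x <= f y.

Definition is_argmax (R : realType) (T : Type) (S : set T) (f : T -> R) (x : T) :=
  S x /\ forall y, S y -> f y <= f x.

(* For a function that is finite everywhere, "closed" is lower semicontinuity
   and properness is automatic. *)
Definition closed_convex_function (R : realType) n (f : 'cV[R]_n -> R) :=
  lower_semicontinuous (EFin \o f) /\ @convex_function R 'cV[R]_n setT f.

Definition closed_convex_set (R : realType) n (S : set 'cV[R]_n) :=
  closed S /\ @convex_set R 'cV[R]_n S.

Inductive constraint_kind := Equality | Inequality.

(* min theta1 x + theta2 y  s.t.  A x + B y = b (or >= b),  x in X,  y in Y *)
Record problem (R : realType) (m n1 n2 : nat) := Problem {
  kind : constraint_kind;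
  theta1 : 'cV[R]_n1 -> R;
  theta2 : 'cV[R]_n2 -> R;
  setX : set 'cV[R]_n1;
  setY : set 'cV[R]_n2;
  Amx : 'M[R]_(m, n1);
  Bmx : 'M[R]_(m, n2);
  bvec : 'cV[R]_m }.

Definition convex_problem (R : realType) m n1 n2 (pb : problem R m n1 n2) :=
  [/\ closed_convex_function (theta1 pb), closed_convex_function (theta2 pb),
      closed_convex_set (setX pb) & closed_convex_set (setY pb)].

Definition setLambda (R : realType) m n1 n2 (pb : problem R m n1 n2) :
    set 'cV[R]_m :=
  match kind pb with
  | Equality => setT
  | Inequality => [set lam | forall i, 0 <= lam i 0]
  end.

Section VariationalInequality.
Context (R : realType) (m n1 n2 : nat) (pb : problem R m n1 n2).

Definition xpart (w : 'cV[R]_(n1 + n2 + m)) : 'cV[R]_n1 := usubmx (usubmx w).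
Definition ypart (w : 'cV[R]_(n1 + n2 + m)) : 'cV[R]_n2 := dsubmx (usubmx w).
Definition lpart (w : 'cV[R]_(n1 + n2 + m)) : 'cV[R]_m := dsubmx w.

Definition Omega : set 'cV[R]_(n1 + n2 + m) :=
  [set w | [/\ setX pb (xpart w), setY pb (ypart w) & setLambda pb (lpart w)]].

Definition theta (w : 'cV[R]_(n1 + n2 + m)) : R :=
  theta1 pb (xpart w) + theta2 pb (ypart w).

Definition Fmap (w : 'cV[R]_(n1 + n2 + m)) : 'cV[R]_(n1 + n2 + m) :=
  col3 (- ((Amx pb)^T *m lpart w)) (- ((Bmx pb)^T *m lpart w))
       (Amx pb *m xpart w + Bmx pb *m ypart w - bvec pb).

Definition Omega_star : set 'cV[R]_(n1 + n2 + m) :=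
  [set ws | Omega ws /\
    forall w, Omega w -> 0 <= theta w - theta ws + dot (w - ws) (Fmap ws)].

Definition Pmx (beta : R) : 'M[R]_(m + m + m, n1 + n2 + m) :=
  block3 (Num.sqrt beta *: Amx pb) 0 0
         0 (Num.sqrt beta *: Bmx pb) 0
         0 0 ((Num.sqrt beta)^-1)%:M.

Definition Xi_star (beta : R) : set 'cV[R]_(m + m + m) :=
  [set Pmx beta *m ws | ws in Omega_star].

End VariationalInequality.

Section PrimalDualAlgorithm.
Context (R : realType) (m n1 n2 : nat) (pb : problem R m n1 n2) (beta nu : R).

Definition prediction (a c lam : 'cV[R]_m)
    (xt : 'cV[R]_n1) (yt : 'cV[R]_n2) (lamt : 'cV[R]_m) : Prop :=
  [/\ is_argmin (setX pb) (fun x =>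
        theta1 pb x - dot x ((Amx pb)^T *m lam)
        + beta / 2 * sqnorm (Amx pb *m x - a)) xt,
      is_argmin (setY pb) (fun y =>
        theta2 pb y - dot y ((Bmx pb)^T *m lam)
        + beta / 2 * sqnorm ((Bmx pb *m y - c) + (Amx pb *m xt - a))) yt
    & is_argmax (setLambda pb) (fun l =>
        - dot l (Amx pb *m xt + Bmx pb *m yt - bvec pb)
        - (2 * beta)^-1 * sqnorm (l - lam)) lamt].

Definition correction (a c lam : 'cV[R]_m)
    (xt : 'cV[R]_n1) (yt : 'cV[R]_n2) (lamt : 'cV[R]_m) : 'cV[R]_(m + m + m) :=
  col3 a c lam
  - block3 nu%:M             (- nu)%:M  0
           0                 nu%:M      0
           (- (nu * beta))%:M 0         1%:M
    *m col3 (a - Amx pb *m xt) (c - Bmx pb *m yt) (lam - lamt).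

(* The subproblems are solvable at every iterate (a, c, lam), not merely along
   one particular run: if A @` X or B @` Y is not closed, solvability along a
   run does not prevent the limit from falling outside Xi_star. *)
Definition subproblems_solvable : Prop :=
  forall a c lam, exists xt yt lamt, prediction a c lam xt yt lamt.

Definition generated (a c lam : nat -> 'cV[R]_m)
    (xt : nat -> 'cV[R]_n1) (yt : nat -> 'cV[R]_n2)
    (lamt : nat -> 'cV[R]_m) : Prop :=
  forall k, prediction (a k) (c k) (lam k) (xt k) (yt k) (lamt k) /\
    col3 (a k.+1) (c k.+1) (lam k.+1)
    = correction (a k) (c k) (lam k) (xt k) (yt k) (lamt k).

Definition scaled (a c lam : 'cV[R]_m) : 'cV[R]_(m + m + m) :=
  col3 (Num.sqrt beta *: a) (Num.sqrt beta *: c) ((Num.sqrt beta)^-1 *: lam).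

End PrimalDualAlgorithm.

Definition Hmx (R : realType) (m : nat) (nu : R) : 'M[R]_(m + m + m) :=
  block3 (1 + nu^-1)%:M (1 + nu^-1)%:M    1%:M
         (1 + nu^-1)%:M (1 + 2 * nu^-1)%:M 1%:M
         1%:M           1%:M              1%:M.

Definition Gmx (R : realType) (m : nat) (nu : R) : 'M[R]_(m + m + m) :=
  block3 (2 - nu)%:M 1%:M       1%:M
         1%:M       (2 - nu)%:M 1%:M
         1%:M       1%:M       1%:M.

(* Main.v *)
(** In the scaled coordinates [xi = P w], the prediction step solves the
variational inequality
[theta w' - theta w + (w' - w)^T F(w) >= (P (w' - w))^T Q (xi - P w)] for all
[w'] in [Omega], and the points of [Omega_star] are the solutions with
[xi = P w]. Since [F] is monotone, any two solutions [(xi, w)], [(xi', w')]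
satisfy [(P w - P w')^T Q g >= 0], where [g] is the difference of the residuals
[xi - P w] and [xi' - P w']. As [H M = Q] and [G = Q + Q^T - M^T H M], this gives
[|xi - xi' - M g|_H^2 <= |xi - xi'|_H^2 - |g|_G^2]. Taking [xi'] in [Xi_star],
where the residual vanishes, yields the claimed inequality, hence boundedness
of the sequence and convergence of its residuals to 0. Taking for [xi'] a
cluster point [p] and for [w'] a solution of the subproblems at [p], the same
inequality bounds [|g|_G] by [|xi - p|_H], so the residual at [p] is 0 and [p] is
in [Xi_star]; Fejer monotonicity then makes the whole sequence converge to [p]. *)
Require Import Defs.
From mathcomp Require Import all_boot all_order all_algebra.
From mathcomp Require Import all_classical all_reals all_analysis.
From mathcomp Require Import ring lra.

Set Implicit Arguments.
Unset Strict Implicit.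
Unset Printing Implicit Defensive.

Import Order.TTheory GRing.Theory Num.Theory.
Import numFieldNormedType.Exports.
Local Open Scope classical_set_scope.
Local Open Scope ring_scope.

(** * Inner products and squared Euclidean norms *)

Section Dot.
Context {R : realType}.

Lemma dotE n (u v : 'cV[R]_n) : dot u v = \sum_i u i 0 * v i 0.
Proof. by rewrite /dot mxE; apply: eq_bigr => i _; rewrite mxE. Qed.

Lemma dotC n (u v : 'cV[R]_n) : dot u v = dot v u.
Proof. by rewrite !dotE; apply: eq_bigr => i _; rewrite mulrC. Qed.

Lemma dotDl n (u v w : 'cV[R]_n) : dot (u + v) w = dot u w + dot v w.
Proof. by rewrite /dot linearD mulmxDl mxE. Qed.

Lemma dotZl n k (u v : 'cV[R]_n) : dot (k *: u) v = k * dot u v.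
Proof. by rewrite /dot linearZ -scalemxAl mxE. Qed.

Lemma dotNl n (u v : 'cV[R]_n) : dot (- u) v = - dot u v.
Proof. by rewrite -scaleN1r dotZl mulN1r. Qed.

Lemma dotDr n (w u v : 'cV[R]_n) : dot w (u + v) = dot w u + dot w v.
Proof. by rewrite dotC dotDl !(dotC w). Qed.

Lemma dotZr n k (v u : 'cV[R]_n) : dot v (k *: u) = k * dot v u.
Proof. by rewrite dotC dotZl dotC. Qed.

Lemma dotNr n (v u : 'cV[R]_n) : dot v (- u) = - dot v u.
Proof. by rewrite dotC dotNl dotC. Qed.

Lemma dot0r n (u : 'cV[R]_n) : dot u 0 = 0.
Proof. by rewrite -(scale0r 0) dotZr mul0r. Qed.

Definition dotl := (dotDl, dotNl, dotZl, dotDr, dotNr, dotZr).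

Lemma dot_trmx p n (A : 'M[R]_(p, n)) u v : dot u (A^T *m v) = dot (A *m u) v.
Proof. by rewrite /dot trmx_mul mulmxA. Qed.

Lemma sqnorm_ge0 n (v : 'cV[R]_n) : 0 <= sqnorm v.
Proof. by rewrite /sqnorm dotE sumr_ge0// => i _; rewrite -expr2 sqr_ge0. Qed.

Lemma sqnormD_le n (u v : 'cV[R]_n) :
  sqnorm (u + v) <= 2 * sqnorm u + 2 * sqnorm v.
Proof.
have := sqnorm_ge0 (u - v).
by rewrite /sqnorm !dotl (dotC v u) => h; lra.
Qed.

Lemma wsqnormE n (H : 'M[R]_n) v : wsqnorm H v = dot v (H *m v).
Proof. by rewrite /wsqnorm /dot mulmxA. Qed.

Lemma dot_col3 p1 p2 p3 (u1 v1 : 'cV[R]_p1) (u2 v2 : 'cV[R]_p2)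
    (u3 v3 : 'cV[R]_p3) :
  dot (col3 u1 u2 u3) (col3 v1 v2 v3) = dot u1 v1 + dot u2 v2 + dot u3 v3.
Proof. by rewrite /dot /col3 !tr_col_mx !mul_row_col !mxE. Qed.

End Dot.

(** * Arithmetic of three-block vectors *)

Section Col3.
Context {R : realType}.

Lemma col3_surj p1 p2 p3 (v : 'cV[R]_(p1 + p2 + p3)) :
  exists u1 u2 u3, v = col3 u1 u2 u3.
Proof.
exists (usubmx (usubmx v)), (dsubmx (usubmx v)), (dsubmx v).
by rewrite /col3 !vsubmxK.
Qed.

Lemma col3D p1 p2 p3 (u1 v1 : 'cV[R]_p1) (u2 v2 : 'cV[R]_p2)
    (u3 v3 : 'cV[R]_p3) :
  col3 u1 u2 u3 + col3 v1 v2 v3 = col3 (u1 + v1) (u2 + v2) (u3 + v3).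
Proof. by rewrite /col3 !add_col_mx. Qed.

Lemma col3N p1 p2 p3 (u1 : 'cV[R]_p1) (u2 : 'cV[R]_p2) (u3 : 'cV[R]_p3) :
  - col3 u1 u2 u3 = col3 (- u1) (- u2) (- u3).
Proof. by rewrite /col3 !opp_col_mx. Qed.

Lemma mul_block3_col3 p1 p2 p3 q1 q2 q3
    (M11 : 'M[R]_(p1, q1)) (M12 : 'M[R]_(p1, q2)) (M13 : 'M[R]_(p1, q3))
    (M21 : 'M[R]_(p2, q1)) (M22 : 'M[R]_(p2, q2)) (M23 : 'M[R]_(p2, q3))
    (M31 : 'M[R]_(p3, q1)) (M32 : 'M[R]_(p3, q2)) (M33 : 'M[R]_(p3, q3))
    u1 u2 u3 :
  block3 M11 M12 M13 M21 M22 M23 M31 M32 M33 *m col3 u1 u2 u3 =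
  col3 (M11 *m u1 + M12 *m u2 + M13 *m u3)
       (M21 *m u1 + M22 *m u2 + M23 *m u3)
       (M31 *m u1 + M32 *m u2 + M33 *m u3).
Proof.
by rewrite /block3 /col3 !mul_block_col mul_row_col mul_col_mx add_col_mx.
Qed.

Lemma xpart_col3 m n1 n2 (x : 'cV[R]_n1) (y : 'cV[R]_n2) (l : 'cV[R]_m) :
  xpart (col3 x y l) = x.
Proof. by rewrite /xpart /col3 !col_mxKu. Qed.

Lemma ypart_col3 m n1 n2 (x : 'cV[R]_n1) (y : 'cV[R]_n2) (l : 'cV[R]_m) :
  ypart (col3 x y l) = y.
Proof. by rewrite /ypart /col3 col_mxKu col_mxKd. Qed.

Lemma lpart_col3 m n1 n2 (x : 'cV[R]_n1) (y : 'cV[R]_n2) (l : 'cV[R]_m) :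
  lpart (col3 x y l) = l.
Proof. by rewrite /lpart /col3 col_mxKd. Qed.

Definition part_col3 := (@xpart_col3, @ypart_col3, @lpart_col3).

End Col3.

(** * First-order optimality without differentiability *)

Section FirstOrder.
Context {R : realType}.

Lemma ge0_of_quadratic_ge0 (p q : R) :
  (forall t, 0 < t -> t < 1 -> 0 <= t * p + t ^+ 2 * q) -> 0 <= p.
Proof.
move=> h; rewrite leNgt; apply/negP => p_lt0.
(* With [t = - p / (2 * s)], [s > - p] gives [t < 1], and [s > q] gives
   [p + t * q <= p + t * s = p / 2 < 0]. *)
pose s := `|q| + 1 - p.
have q0 := normr_ge0 q; have qle := ler_norm q.
have s0 : 0 < s by rewrite /s; lra.
have t0 : 0 < - p / (2 * s) by rewrite divr_gt0 //; lra.
have ts : - p / (2 * s) * s = - p / 2 by field; rewrite gt_eqF.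
have := h _ t0; set t := - p / (2 * s) in t0 ts *.
have t1 : t < 1.
  by rewrite /t ltr_pdivrMr; [rewrite /s; lra | lra].
move=> /(_ t1); rewrite expr2 -mulrA -mulrDr pmulr_rge0//.
have : t * q <= t * s by rewrite ler_pM2l// /s; lra.
by rewrite ts; lra.
Qed.

(** Compare [z] with [z + t (x - z)] for small [t]: convexity bounds the increment of [f] linearly
    in [t], so only the quadratic term is differentiated. *)
Lemma argmin_first_order n p (S : set 'cV[R]_n) (f : 'cV[R]_n -> R)
    (M : 'M[R]_(p, n)) l r s z :
  convex_set S -> convex_function setT f ->
  is_argmin S (fun x => f x - dot x l + s / 2 * sqnorm (M *m x - r)) z ->
  forall x, S x ->
  0 <= f x - f z - dot (x - z) l + s * dot (M *m (x - z)) (M *m z - r).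
Proof.
move=> cS cf [Sz zmin] x Sx.
apply: (@ge0_of_quadratic_ge0 _ (s / 2 * sqnorm (M *m (x - z)))) => t t0 t1.
have ti : Itv.spec (Itv.num_sem (R:=R)) (Itv.Real `[0%Z, 1%Z]) t.
  by rewrite /= /Itv.num_sem /= num_real in_itv/= !ltW.
pose t01 : {i01 R} := Itv.mk ti.
have xz : t *: x + (1 - t) *: z = z + t *: (x - z).
  by rewrite scalerBl scale1r scalerBr addrCA addrA.
have Sxz : S (z + t *: (x - z)).
  rewrite -xz; have := cS x z t01; rewrite !inE; exact.
have := cf t01 x z; rewrite !inE => /(_ I I).
move=> fle; have := zmin _ Sxz.
have {}fle : f (z + t *: (x - z)) <= t * f x + (1 - t) * f z.
  by rewrite -xz; exact: fle.
set v := M *m (x - z); set u := M *m z - r.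
have -> : M *m (z + t *: (x - z)) - r = u + t *: v.
  by rewrite mulmxDr -scalemxAr addrAC.
clearbody u v; rewrite /sqnorm !dotl (dotC v u) expr2; lra.
Qed.

End FirstOrder.

(** * The quadratic forms of [H] and [G] *)

Lemma wsqnormN (R : realType) n (H : 'M[R]_n) v : wsqnorm H (- v) = wsqnorm H v.
Proof. by rewrite !wsqnormE mulmxN !dotl opprK. Qed.

Section QuadraticForms.
Context {R : realType} (m : nat) (nu : R).

(** The second row reflects that the [y]-subproblem uses the new [x]; the last column, that both
    primal subproblems use the old multiplier while [F] uses the new one. *)
Definition Qmx : 'M[R]_(m + m + m) :=
  block3 1%:M 0    1%:M
         1%:M 1%:M 1%:M
         0    0    1%:M.

(** The correction matrix in scaled coordinates, where [beta] disappears. *)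
Definition Mmx : 'M[R]_(m + m + m) :=
  block3 nu%:M     (- nu)%:M 0
         0         nu%:M     0
         (- nu)%:M 0         1%:M.

(** Completing squares exhibits positive definiteness for [nu > 0]. *)
Lemma wsqnorm_H (u v w : 'cV[R]_m) : wsqnorm (Hmx m nu) (col3 u v w) =
  sqnorm (u + v + w) + nu^-1 * sqnorm (u + v) + nu^-1 * sqnorm v.
Proof.
rewrite wsqnormE mul_block3_col3 dot_col3 !mul_scalar_mx /sqnorm !dotl.
by rewrite (dotC v u) (dotC w u) (dotC w v); ring.
Qed.

(** The weights are positive exactly when [nu < 1]. *)
Lemma wsqnorm_G (u v w : 'cV[R]_m) : wsqnorm (Gmx m nu) (col3 u v w) =
  sqnorm (u + v + w) + (1 - nu) * sqnorm u + (1 - nu) * sqnorm v.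
Proof.
rewrite wsqnormE mul_block3_col3 dot_col3 !mul_scalar_mx /sqnorm !dotl.
by rewrite (dotC v u) (dotC w u) (dotC w v); ring.
Qed.

Lemma sqnorm_col3 (u v w : 'cV[R]_m) :
  sqnorm (col3 u v w) = sqnorm u + sqnorm v + sqnorm w.
Proof. exact: dot_col3. Qed.

Hypotheses (nu_gt0 : 0 < nu) (nu_lt1 : nu < 1).

Lemma inv_nu_ge1 : 1 <= nu^-1.
Proof. by rewrite invr_ge1 ?unitfE ?gt_eqF// ltW. Qed.

(** The left side is at most [2 |x+y+z|^2 + 4 |x+y|^2 + 3 |y|^2], and [nu^-1 >= 1]; the constant 9
    is not sharp. *)
Lemma wsqnorm_H_ge (v : 'cV[R]_(m + m + m)) :
  sqnorm v <= 9 * wsqnorm (Hmx m nu) v.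
Proof.
have [x [y [z ->]]] := col3_surj v; rewrite wsqnorm_H sqnorm_col3.
have := sqnormD_le (x + y) (- y); have := sqnormD_le (x + y + z) (- (x + y)).
rewrite addrK (addrAC _ z) addrN add0r.
have sN (u : 'cV[R]_m) : sqnorm (- u) = sqnorm u.
  by rewrite /sqnorm !dotl opprK.
rewrite !sN.
have := sqnorm_ge0 (x + y + z); have := sqnorm_ge0 (x + y).
have := sqnorm_ge0 y; have := inv_nu_ge1; move: (nu^-1) => k; nra.
Qed.

Lemma wsqnorm_H_le (v : 'cV[R]_(m + m + m)) :
  wsqnorm (Hmx m nu) v <= (4 + 3 * nu^-1) * sqnorm v.
Proof.
have [x [y [z ->]]] := col3_surj v; rewrite wsqnorm_H sqnorm_col3.
have := sqnormD_le (x + y) z; have := sqnormD_le x y.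
have := sqnorm_ge0 x; have := sqnorm_ge0 y; have := sqnorm_ge0 z.
have := inv_nu_ge1; move: (nu^-1) => k; nra.
Qed.

Lemma wsqnorm_G_ge0 (v : 'cV[R]_(m + m + m)) : 0 <= wsqnorm (Gmx m nu) v.
Proof.
have [x [y [z ->]]] := col3_surj v; rewrite wsqnorm_G.
by rewrite !addr_ge0 ?mulr_ge0 ?sqnorm_ge0// subr_ge0 ltW.
Qed.

Lemma sqnorm_eq0 n (v : 'cV[R]_n) : sqnorm v = 0 -> v = 0.
Proof.
rewrite /sqnorm dotE => /eqP; rewrite psumr_eq0; last first.
  by move=> i _; rewrite -expr2 sqr_ge0.
move=> /allP v0; apply/colP => i; rewrite mxE.
by have := v0 i (mem_index_enum _); rewrite /= -expr2 sqrf_eq0 => /eqP.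
Qed.

Lemma wsqnorm_G_eq0 (v : 'cV[R]_(m + m + m)) :
  wsqnorm (Gmx m nu) v <= 0 -> v = 0.
Proof.
have [x [y [z ->]]] := col3_surj v; rewrite wsqnorm_G => le0.
have nu1 : 0 < 1 - nu by rewrite subr_gt0.
have xge0 := mulr_ge0 (ltW nu1) (sqnorm_ge0 x).
have yge0 := mulr_ge0 (ltW nu1) (sqnorm_ge0 y).
have xyz := sqnorm_ge0 (x + y + z).
have x0 : sqnorm x = 0 by apply: (mulfI (lt0r_neq0 nu1)); lra.
have y0 : sqnorm y = 0 by apply: (mulfI (lt0r_neq0 nu1)); lra.
have {xyz} : sqnorm (x + y + z) = 0 by lra.
move/sqnorm_eq0; rewrite (sqnorm_eq0 x0) (sqnorm_eq0 y0) !add0r => ->.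
by rewrite /col3 !col_mx0.
Qed.

Lemma wsqnorm_GD_le (u v : 'cV[R]_(m + m + m)) :
  wsqnorm (Gmx m nu) (u + v) <=
  2 * wsqnorm (Gmx m nu) u + 2 * wsqnorm (Gmx m nu) v.
Proof.
have [x [y [z ->]]] := col3_surj u; have [x' [y' [z' ->]]] := col3_surj v.
rewrite col3D !wsqnorm_G.
rewrite (_ : x + x' + (y + y') + (z + z') = (x + y + z) + (x' + y' + z')).
  have := sqnormD_le (x + y + z) (x' + y' + z').
  have nu1 : 0 <= 1 - nu by rewrite subr_ge0 ltW.
  have := ler_wpM2l nu1 (sqnormD_le x x').
  have := ler_wpM2l nu1 (sqnormD_le y y'); lra.
by rewrite (addrACA x) (addrACA (x + y)).
Qed.

(* [H M = Q] and [G = Q + Q^T - M^T H M]. *)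
Lemma wsqnorm_step (d g : 'cV[R]_(m + m + m)) :
  wsqnorm (Hmx m nu) (d - Mmx *m g) =
  wsqnorm (Hmx m nu) d - wsqnorm (Gmx m nu) g - 2 * dot (d - g) (Qmx *m g).
Proof.
have [x [y [z ->]]] := col3_surj d; have [x' [y' [z' ->]]] := col3_surj g.
rewrite !mul_block3_col3 !mul_scalar_mx !mul0mx !col3N !col3D dot_col3.
rewrite !wsqnorm_H wsqnorm_G /sqnorm !add0r !addr0 !scale1r !scaleNr !dotl.
rewrite (dotC y x) (dotC z x) (dotC z y) (dotC y' x') (dotC z' x') (dotC z' y').
rewrite !(dotC x' x, dotC x' y, dotC x' z, dotC y' x, dotC y' y, dotC y' z).
rewrite !(dotC z' x, dotC z' y, dotC z' z).
by field; rewrite gt_eqF.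
Qed.

End QuadraticForms.

(** * The prediction step as a monotone variational inequality *)

Section PredictionVI.
Context {R : realType} (m n1 n2 : nat) (pb : problem R m n1 n2) (beta : R).
Hypothesis beta_gt0 : 0 < beta.

Local Notation A := (Amx pb).
Local Notation B := (Bmx pb).
Local Notation P := (Pmx pb beta).
Local Notation Q := (Qmx m).

Lemma sqrt_beta_neq0 : Num.sqrt beta != 0.
Proof. by rewrite gt_eqF// sqrtr_gt0. Qed.

Lemma Pmx_col3 x y l : P *m col3 x y l = scaled beta (A *m x) (B *m y) l.
Proof.
rewrite /Pmx mul_block3_col3 !mul0mx !addr0 !add0r /scaled.
by rewrite -!scalemxAl mul_scalar_mx.
Qed.

Lemma scaledB (a c l a' c' l' : 'cV[R]_m) :
  scaled beta a c l - scaled beta a' c' l' =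
  scaled beta (a - a') (c - c') (l - l').
Proof. by rewrite /scaled col3N col3D -!scalerBr. Qed.

Lemma scaled_surj (v : 'cV[R]_(m + m + m)) :
  exists a c l, v = scaled beta a c l.
Proof.
have [a [c [l ->]]] := col3_surj v; have s0 := sqrt_beta_neq0.
exists ((Num.sqrt beta)^-1 *: a), ((Num.sqrt beta)^-1 *: c).
by exists (Num.sqrt beta *: l); rewrite /scaled !scalerA divff// mulVf// !scale1r.
Qed.

Lemma dot_scaled_Q (p q r d e f : 'cV[R]_m) :
  dot (scaled beta p q r) (Q *m scaled beta d e f) =
  beta * (dot p d + dot q (d + e)) + dot p f + dot q f + beta^-1 * dot r f.
Proof.
rewrite mul_block3_col3 !mul1mx !mul0mx !addr0 !add0r dot_col3 !dotl.
have := sqrt_beta_neq0; rewrite -[beta in RHS](sqr_sqrtr (ltW beta_gt0)).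
by move: (Num.sqrt beta) => s s0; field.
Qed.

(* The optimality conditions of the prediction step as one variational
   inequality; its solutions with [xi = P w] are the points of [Omega_star]. *)
Definition prediction_VI xi w :=
  Omega pb w /\ forall w', Omega pb w' ->
    dot (P *m (w' - w)) (Q *m (xi - P *m w)) <=
    theta pb w' - theta pb w + dot (w' - w) (Fmap pb w).

Lemma Omega_star_VI w : Omega_star pb w <-> prediction_VI (P *m w) w.
Proof.
by split=> -[Ow VI]; split=> // w' /VI; rewrite subrr mulmx0 dot0r.
Qed.

(** [F] is affine with a skew-symmetric linear part. *)
Lemma Fmap_skew w w' : dot (w - w') (Fmap pb w - Fmap pb w') = 0.
Proof.
have [x [y [l ->]]] := col3_surj w; have [x' [y' [l' ->]]] := col3_surj w'.
rewrite /Fmap !part_col3 !col3N !col3D dot_col3 !opprK.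
by rewrite !dotl !dot_trmx !(dotC l) !(dotC l'); ring.
Qed.

(** Test each inequality with the other solution and add: the [theta] terms cancel, and the [F]
    terms cancel by skewness. *)
Lemma prediction_VI_monotone xi w xi' w' :
  prediction_VI xi w -> prediction_VI xi' w' ->
  0 <= dot (P *m (w - w')) (Q *m ((xi - P *m w) - (xi' - P *m w'))).
Proof.
move=> [Ow VI] [Ow' VI']; move: {VI}(VI _ Ow') {VI'}(VI' _ Ow) => VI VI'.
have := Fmap_skew w w'; rewrite -(opprB w w') in VI; move: VI VI'.
by rewrite mulmxN [Q *m (_ - (_ - _))]mulmxBr !dotl; lra.
Qed.

Lemma Lambda_convex : convex_set (setLambda pb).
Proof.
rewrite /setLambda; case: kind => x y t; rewrite !inE// => /= x0 y0 i.
by rewrite !mxE addr_ge0// mulr_ge0// subr_ge0.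
Qed.

Lemma convex_function_cst n (k : R) :
  @convex_function R 'cV[R]_n setT (fun=> k).
Proof. by move=> t x y _ _; rewrite convmm. Qed.

Lemma prediction_VIP a c lam x y l : convex_problem pb ->
  prediction pb beta a c lam x y l ->
  prediction_VI (scaled beta a c lam) (col3 x y l).
Proof.
move=> [[_ c1] [_ c2] [_ cX] [_ cY]] [mx my [Ll ml]].
have VIx := argmin_first_order cX c1 mx.
have {}my : is_argmin (Defs.setY pb) (fun v => theta2 pb v - dot v (B^T *m lam)
    + beta / 2 * sqnorm (B *m v - (c - (A *m x - a)))) y.
  case: my => Yy my; split=> // v /my.
  by rewrite !(opprD c) !opprK !addrA.
have VIy := argmin_first_order cY c2 my.
(* The multiplier step fits the same scheme with zero convex term, identity matrix and weight
   [beta^-1]. *)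
have {}ml : is_argmin (setLambda pb)
    (fun v => 0 - dot v (- (A *m x + B *m y - bvec pb))
    + beta^-1 / 2 * sqnorm (1%:M *m v - lam)) l.
  split=> // v /ml; rewrite !mul1mx !dotl invfM; lra.
have VIl := argmin_first_order Lambda_convex (convex_function_cst 0) ml.
case: mx my => Xx _ [Yy _].
split=> [|w']; first by rewrite /Omega /= !part_col3.
have [x' [y' [l' ->]]] := col3_surj w'.
rewrite /Omega /= !part_col3 => -[/VIx {}VIx /VIy {}VIy /VIl {}VIl].
move: VIx VIy VIl.
rewrite /theta /Fmap !part_col3 Pmx_col3 scaledB col3N col3D Pmx_col3.
rewrite dot_scaled_Q dot_col3 !mul1mx !(dotNr _ (_ *m _)) !dot_trmx.
set p := A *m (x' - x); set q := B *m (y' - y); set r := l' - l.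
by rewrite !(dotDr p, dotDr q, dotDr r, dotNr); lra.
Qed.

End PredictionVI.

(** * Cluster points and Fejer monotone sequences *)

Section FejerConvergence.
Context {R : realType}.

Lemma normr_trmx m n (v : 'M[R]_(m, n)) : `|v^T| = `|v|.
Proof.
rewrite [LHS]/Num.norm [RHS]/Num.norm /= !mx_normrE; apply/eqP; rewrite eq_le; apply/andP; split.
  apply/bigmax_leP; split=> [|[i j] _]; first exact: bigmax_ge_id.
  by rewrite mxE; exact: (le_bigmax _ (fun ij => `|v ij.1 ij.2|) (j, i)).
apply/bigmax_leP; split=> [|[i j] _]; first exact: bigmax_ge_id.
have := le_bigmax (0 : R) (fun ij => `|v^T ij.1 ij.2|) (j, i).
by rewrite /= mxE.
Qed.

Lemma normr_sqr_le_sqnorm n (v : 'cV[R]_n) : `|v| ^+ 2 <= sqnorm v.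
Proof.
have [/eqP v0|v0] := boolP (`|v| == 0); first by rewrite v0 expr0n sqnorm_ge0.
have [[i j] vij] := mx_norm_neq0 v0; rewrite [`|v|]vij /=.
rewrite (ord1 j) real_normK ?num_real// /sqnorm dotE (bigD1 i)//= expr2 lerDl.
by rewrite sumr_ge0// => k _; rewrite -expr2 sqr_ge0.
Qed.

Lemma sqnorm_le_normr_sqr n (v : 'cV[R]_n) : sqnorm v <= n%:R * `|v| ^+ 2.
Proof.
rewrite /sqnorm dotE -[n in n%:R]card_ord mulr_natl -sumr_const.
apply: ler_sum => i _; rewrite -expr2 -[leLHS]real_normK ?num_real//.
rewrite ler_pXn2r ?nnegrE//.
rewrite [leRHS]/Num.norm /= mx_normrE.
exact: (le_bigmax _ (fun ij => `|v ij.1 ij.2|) (i, 0)).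
Qed.

(** Bolzano-Weierstrass, obtained by transposing to row vectors, where closed bounded sets are
    compact. *)
Lemma bounded_cluster n (u : nat -> 'cV[R]_n) (M : R) :
  (forall k, `|u k| <= M) ->
  exists p, forall e N, 0 < e -> exists2 k, (N <= k)%N & sqnorm (u k - p) < e.
Proof.
move=> uM; pose S := [set v : 'rV[R]_n | `|v| <= M].
have cS : compact S.
  apply: bounded_closed_compact.
    exists M; split=> [|x Mx v Sv]; first exact: num_real.
    exact: le_trans Sv (ltW Mx).
  apply: (@closed_comp _ _ (fun v : 'rV[R]_n => `|v|) [set x | x <= M]).
    by move=> v _; exact: norm_continuous.
  exact: closed_le.
have uF : ProperFilter ((fun k => (u k)^T) @ \oo).
  exact: fmap_proper_filter.
have [|p [_ clp]] := cS _ uF.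
  by exists 0%N => // k _; rewrite /S /= normr_trmx.
exists p^T => e N e0.
(* Chosen so that [n.+1 * r^2 = e]; [n.+1] keeps the quotient meaningful for [n = 0]. *)
pose r := Num.sqrt (e / n.+1%:R).
have r0 : 0 < r by rewrite sqrtr_gt0 divr_gt0.
have [] := clp ((fun k => (u k)^T) @` [set k | (N <= k)%N]) (ball p r).
- by exists N => // k /= Nk; exists k.
- exact: nbhsx_ballx.
- move=> _ [[k Nk <-]]; rewrite -ball_normE /= => upr; exists k => //.
  have {}upr : `|u k - p^T| < r.
    by rewrite distrC -normr_trmx linearB /= trmxK.
  apply: (le_lt_trans (sqnorm_le_normr_sqr _)).
  apply: (@le_lt_trans _ _ (n.+1%:R * `|u k - p^T| ^+ 2)).
    by rewrite ler_wpM2r ?sqr_ge0// ler_nat.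
  rewrite mulrC -ltr_pdivlMr// -[ltRHS]sqr_sqrtr ?divr_ge0 ?ltW//.
  by rewrite ltr_pXn2r ?nnegrE// ltW.
Qed.

(** [V] decreases to a limit, so its consecutive differences, which dominate [r], tend to 0. *)
Lemma decrement_eventually_lt (V r : nat -> R) :
  (forall k, 0 <= V k) -> (forall k, V k.+1 <= V k - r k) ->
  (forall k, 0 <= r k) ->
  forall e, 0 < e -> exists N, forall k, (N <= k)%N -> r k < e.
Proof.
move=> V0 Vr r0 e e0.
have dV : nonincreasing_seq V.
  by apply/nonincreasing_seqP => k; rewrite (le_trans (Vr k))// gerBl.
have cV : V @ \oo --> inf (range V).
  by apply: nonincreasing_cvgn => //; exists 0 => _ [k _ <-].
have e20 : 0 < e / 2 by lra.
move/cvgrPdist_lt: cV => /(_ _ e20)[N _ hN].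
exists N => k Nk; have := hN _ Nk; have := hN _ (leqW Nk).
rewrite /= !ltr_norml => /andP[_ h1] /andP[h2 _].
have := Vr k; lra.
Qed.

(** A single index with small [V (u k - p)] suffices, since all later values stay below it. *)
Lemma fejer_cvg n (V : 'cV[R]_n -> R) (K : R) (u : nat -> 'cV[R]_n) p :
  0 < K -> (forall v, sqnorm v <= K * V v) ->
  (forall k, V (u k.+1 - p) <= V (u k - p)) ->
  (forall e, 0 < e -> exists k, V (u k - p) < e) ->
  u @ \oo --> p.
Proof.
move=> K0 geV Vdec clp; apply/cvgrPdist_lt => e e0.
have [|N uN] := clp (e ^+ 2 / K); first by rewrite divr_gt0// exprn_gt0.
exists N => // k /= Nk; rewrite distrC.
have Vk : V (u k - p) <= V (u N - p).
  rewrite -(subnK Nk); elim: (k - N)%N => [//|j ih].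
  by rewrite addSn (le_trans (Vdec _)).
have : `|u k - p| ^+ 2 < e ^+ 2.
  apply: (le_lt_trans (normr_sqr_le_sqnorm _)).
  apply: (le_lt_trans (geV _)).
  by rewrite mulrC -ltr_pdivlMr// (le_lt_trans Vk).
by rewrite ltr_pXn2r ?nnegrE// ltW.
Qed.

End FejerConvergence.

(** * Contraction estimate and the correction step in scaled coordinates *)

Section Contraction.
Context {R : realType} (m n1 n2 : nat) (pb : problem R m n1 n2) (beta nu : R).
Hypotheses (beta_gt0 : 0 < beta) (nu_gt0 : 0 < nu) (nu_lt1 : nu < 1).

Local Notation P := (Pmx pb beta).
Local Notation H := (Hmx m nu).
Local Notation G := (Gmx m nu).

(** Kept for two arbitrary solutions, because [xi'] will also be a cluster point not yet known to
    lie in [Xi_star]. *)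
Lemma prediction_VI_contraction xi w xi' w' :
  prediction_VI pb beta xi w -> prediction_VI pb beta xi' w' ->
  wsqnorm H (xi - xi' - Mmx m nu *m ((xi - P *m w) - (xi' - P *m w'))) <=
  wsqnorm H (xi - xi') - wsqnorm G ((xi - P *m w) - (xi' - P *m w')).
Proof.
move=> VI VI'; set g := (xi - _ - (_ - _)); rewrite (wsqnorm_step nu_gt0).
have := prediction_VI_monotone VI VI'; rewrite -/g.
rewrite (_ : P *m (w - w') = xi - xi' - g); first by lra.
by rewrite /g mulmxBr opprB addrA subrKA addrC opprB subrKA.
Qed.

Lemma correction_scaled a c lam a' c' lam' x y l :
  col3 a' c' lam' = correction pb beta nu a c lam x y l ->
  scaled beta a' c' lam' =
  scaled beta a c lam
  - Mmx m nu *m (scaled beta a c lam - P *m col3 x y l).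
Proof.
rewrite /correction mul_block3_col3 col3N col3D.
move=> /eq_col_mx[/eq_col_mx[-> ->] ->].
rewrite Pmx_col3 scaledB mul_block3_col3 col3N col3D.
rewrite !mul_scalar_mx !mul0mx !addr0 !add0r !scale1r /scaled.
have := sqrt_beta_neq0 beta_gt0.
rewrite -[beta in nu * beta](sqr_sqrtr (ltW beta_gt0)).
move: (Num.sqrt beta) (Amx pb *m x) (Bmx pb *m y) => s u v s0.
by congr col3; apply/colP => i; rewrite !mxE; field.
Qed.

(** Every vector is a scaled triple, so this applies at a cluster point and not only at iterates. *)
Lemma prediction_VI_solvable : convex_problem pb ->
  subproblems_solvable pb beta ->
  forall xi, exists w, prediction_VI pb beta xi w.
Proof.
move=> cpb solv xi; have [a [c [lam ->]]] := scaled_surj beta_gt0 xi.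
have [x [y [l pred]]] := solv a c lam.
by exists (col3 x y l); apply: prediction_VIP.
Qed.

End Contraction.

Theorem theorem4p1 (R : realType) (m n1 n2 : nat) (pb : problem R m n1 n2)
    (beta nu : R)
    (a c lam : nat -> 'cV[R]_m)
    (xt : nat -> 'cV[R]_n1) (yt : nat -> 'cV[R]_n2) (lamt : nat -> 'cV[R]_m)
    (xi xit : nat -> 'cV[R]_(m + m + m))
    (pb_convex : convex_problem pb)
    (Omega_star_nonempty : Omega_star pb !=set0)
    (beta_gt0 : 0 < beta) (nu_gt0 : 0 < nu) (nu_lt1 : nu < 1)
    (solvable : subproblems_solvable pb beta)
    (iterates : generated pb beta nu a c lam xt yt lamt)
    (xiE : forall k, xi k = scaled beta (a k) (c k) (lam k))
    (xitE : forall k, xit k = Pmx pb beta *m col3 (xt k) (yt k) (lamt k)) :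
  (forall (k : nat) (xis : 'cV[R]_(m + m + m)), Xi_star pb beta xis ->
     wsqnorm (Hmx m nu) (xi k.+1 - xis)
     <= wsqnorm (Hmx m nu) (xi k - xis) - wsqnorm (Gmx m nu) (xi k - xit k))
  /\ exists2 xis : 'cV[R]_(m + m + m), Xi_star pb beta xis & xi @ \oo --> xis.
Proof.
have VI k : prediction_VI pb beta (xi k) (col3 (xt k) (yt k) (lamt k)).
  by rewrite xiE; apply: prediction_VIP => //; case: (iterates k).
have xiS k : xi k.+1 = xi k - Mmx m nu *m (xi k - xit k).
  by rewrite !xiE xitE; apply: correction_scaled => //; case: (iterates k).
have fejer k xis : Xi_star pb beta xis ->
    wsqnorm (Hmx m nu) (xi k.+1 - xis)
    <= wsqnorm (Hmx m nu) (xi k - xis) - wsqnorm (Gmx m nu) (xi k - xit k).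
  move=> [ws /(Omega_star_VI _ beta) VIs <-].
  have := prediction_VI_contraction nu_gt0 (VI k) VIs.
  by rewrite /= subrr subr0 -xitE xiS addrAC.
split=> //; case: Omega_star_nonempty => ws Ows.
have Xws : Xi_star pb beta (Pmx pb beta *m ws) by exists ws.
set xs := Pmx pb beta *m ws in Xws.
have VH0 v : 0 <= wsqnorm (Hmx m nu) v.
  by have := wsqnorm_H_ge nu_gt0 nu_lt1 v; have := sqnorm_ge0 v; lra.
have VG0 := @wsqnorm_G_ge0 R m nu nu_lt1.
have dcvg := decrement_eventually_lt (fun k => VH0 (xi k - xs)) (fejer^~ xs ^~ Xws)
  (fun k => VG0 (xi k - xit k)).
have fejer_le k xis : Xi_star pb beta xis ->
    wsqnorm (Hmx m nu) (xi k.+1 - xis) <= wsqnorm (Hmx m nu) (xi k - xis).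
  by move=> /(fejer k) /le_trans; apply; rewrite gerBl.
have geH := @wsqnorm_H_ge R m nu nu_gt0 nu_lt1.
(* With [t] the norm of [xi k - xs], [t <= t^2 + 1] turns the bound on [t^2] into one on [t] without
   square roots. *)
have xiB k : `|xi k| <= `|xs| + (9 * wsqnorm (Hmx m nu) (xi 0%N - xs) + 1).
  rewrite -[xi k](subrK xs) addrC (le_trans (ler_normD _ _))// lerD2l.
  have Vk : wsqnorm (Hmx m nu) (xi k - xs) <= wsqnorm (Hmx m nu) (xi 0%N - xs).
    by elim: k => [//|k ih]; rewrite (le_trans (fejer_le _ _ Xws)).
  have := normr_sqr_le_sqnorm (xi k - xs); have := geH (xi k - xs).
  have := sqr_ge0 (`|xi k - xs| - 1); move: (`|xi k - xs|) => t; nra.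
have [p clp] := bounded_cluster xiB.
have Vclp e N : 0 < e ->
    exists2 k, (N <= k)%N & wsqnorm (Hmx m nu) (xi k - p) < e.
  move=> e0; have K0 : 0 < 4 + 3 * nu^-1.
    by rewrite addr_gt0// mulr_gt0// invr_gt0.
  have [|k Nk pk] := clp (e / (4 + 3 * nu^-1)) N; first exact: divr_gt0.
  exists k => //; apply: (le_lt_trans (wsqnorm_H_le nu_gt0 nu_lt1 _)).
  by rewrite mulrC -ltr_pdivlMr.
have [w VIp] := prediction_VI_solvable beta_gt0 pb_convex solvable p.
have pw : p - Pmx pb beta *m w = 0.
  apply: (wsqnorm_G_eq0 nu_lt1); apply/ler_addgt0Pr => e e0; rewrite add0r.
  (* Some [k] makes both [|d|_G^2] and [|xi k - p|_H^2] less than [e / 4]; the latter bounds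
     [|d - r|_G^2], so [|r|_G^2 <= 2 |d - r|_G^2 + 2 |d|_G^2 < e]. *)
  have e40 : 0 < e / 4 by lra.
  have [N dN] := dcvg _ e40; have [k Nk pk] := Vclp _ N e40.
  have := prediction_VI_contraction nu_gt0 (VI k) VIp; rewrite /= -xitE.
  set d := xi k - xit k; set r := p - _.
  have := VH0 (xi k - p - Mmx m nu *m (d - r)).
  have := dN _ Nk; rewrite -/d.
  have := wsqnorm_GD_le nu_lt1 (- (d - r)) d; rewrite opprB subrK.
  rewrite -(wsqnormN _ (r - d)) opprB; lra.
have {pw} pE : p = Pmx pb beta *m w by apply/eqP; rewrite -subr_eq0 pw.
exists p; first by exists w => //; apply/(Omega_star_VI _ beta); rewrite -pE.
apply: (fejer_cvg (V := wsqnorm (Hmx m nu)) (K := 9)) => //.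
  by move=> k; apply: fejer_le; exists w => //; apply/(Omega_star_VI _ beta); rewrite -pE.
by move=> e /(Vclp _ 0%N)[k _ ?]; exists k.
Qed.
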